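(* Let $G_1$, $G_2$ be groups and let $H\le G_1\times G_2$ be a subgroup. There exist simple, undirected, connected graphs $\mathcal{G}_1$, $\mathcal{G}_2$ and a graph morphism $\varphi\colon \mathcal{G}_1\to\mathcal{G}_2$ such that $\operatorname{Aut}(\varphi)\cong H$ and $\operatorname{Aut}(\mathcal{G}_i)\cong G_i$ for $i=1,2$.
   Context: Groups are arbitrary (possibly infinite) and graphs may be infinite. $\mathcal{G}raphs$ is the category of simple, undirected, connected graphs; a morphism $\mathcal{G}\to\mathcal{G}'$ is a map $V(\mathcal{G})\to V(\mathcal{G}')$ on vertices sending edges to edges. $\operatorname{Aut}(\mathcal{G})$ is the automorphism group in this category. For a morphism $\varphi\colon\mathcal{G}_1\to\mathcal{G}_2$, $\operatorname{Aut}(\varphi)$ is its automorphism group as an object of the arrow category, i.e. the group of pairs $(a,b)\in\operatorname{Aut}(\mathcal{G}_1)\times\operatorname{Aut}(\mathcal{G}_2)$ with $b\circ\varphi=\varphi\circ a$. *)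

(* Defs.v *)
From Stdlib Require Relation_Operators.
From HB Require Import structures.
From mathcomp Require Import all_boot all_classical.
Set Implicit Arguments. Unset Strict Implicit. Unset Printing Implicit Defensive.

Local Open Scope group_scope.
Local Open Scope classical_set_scope.

(* The choice structure carried by every [groupType] is no restriction on the
   group: [gen_choiceMixin] provides one on any type. *)

Definition group_iso (G H : groupType) : Prop :=
  exists f : {multiplicative G -> H}, bijective f.

Section Subgroup.
Variables (G : groupType) (S : set G).

Record subgroup (hS : group_closed (mem S)) : Type := Subgroup {
  subgroup_val :> G;
  subgroup_valP : subgroup_val \in mem S
}.

Variable hS : group_closed (mem S).

HB.instance Definition _ := [isSub for @subgroup_val hS].
HB.instance Definition _ := [Choice of subgroup hS by <:].
HB.instance Definition _ :=
  SubChoice_isSubGroup.Build G (mem S) (subgroup hS) hS.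

End Subgroup.

(* A connected graph is in particular nonempty. *)
Record graph := Graph {
  vertex :> Type;
  adj : vertex -> vertex -> Prop;
  adj_sym : forall x y, adj x y -> adj y x;
  adj_irr : forall x, ~ adj x x;
  graph_nonempty : inhabited vertex;
  graph_connected :
    forall x y, Relation_Operators.clos_refl_trans vertex adj x y
}.

Record graph_hom (X Y : graph) := GraphHom {
  hom_fun :> X -> Y;
  hom_adj : forall x y, adj x y -> adj (hom_fun x) (hom_fun y)
}.

(* Invertible endomorphisms: the inverse is itself required to be a morphism,
   so that a bijective morphism which is not an isomorphism is excluded. *)
Record graph_aut (X : graph) := GraphAut {
  aut_hom :> graph_hom X X;
  aut_inv : graph_hom X X;
  aut_homK : cancel aut_hom aut_inv;
  aut_invK : cancel aut_inv aut_hom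
}.

Section AutGroup.
Variable X : graph.
Implicit Types a b c : graph_aut X.

Lemma graph_hom_ext (Y : graph) (f g : graph_hom X Y) : f =1 g -> f = g.
Proof.
case: f g => [f hf] [g hg] /= /funext fg; case: _ / fg in hg *.
by congr GraphHom; exact: Prop_irrelevance.
Qed.

Lemma graph_aut_ext a b : a =1 b -> a = b.
Proof.
case: a b => [f f' fK f'K] [g g' gK g'K] /= fg.
have ef : f = g by exact: graph_hom_ext.
case: _ / ef in fg gK g'K *.
have ef' : f' = g' by apply: graph_hom_ext => x; rewrite -[x in LHS]g'K fK.
case: _ / ef' in gK g'K *.
by congr GraphAut; exact: Prop_irrelevance.
Qed.

Definition id_hom : graph_hom X X := GraphHom (fun x y (h : adj x y) => h).

Definition comp_hom (g f : graph_hom X X) : graph_hom X X :=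
  GraphHom (fun x y (h : adj x y) => hom_adj g (hom_adj f h)).

Definition aut_one : graph_aut X :=
  @GraphAut X id_hom id_hom (fun=> erefl) (fun=> erefl).

Definition aut_mul a b : graph_aut X :=
  @GraphAut X (comp_hom a b) (comp_hom (aut_inv b) (aut_inv a))
    (can_comp (@aut_homK X a) (@aut_homK X b))
    (can_comp (@aut_invK X b) (@aut_invK X a)).

Definition aut_invg a : graph_aut X := GraphAut (@aut_invK X a) (@aut_homK X a).

Lemma aut_mulA : associative aut_mul.
Proof. by move=> a b c; exact: graph_aut_ext. Qed.

Lemma aut_mul1 : left_id aut_one aut_mul.
Proof. by move=> a; exact: graph_aut_ext. Qed.

Lemma aut_mulr1 : right_id aut_one aut_mul.
Proof. by move=> a; exact: graph_aut_ext. Qed.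

Lemma aut_mulV : left_inverse aut_one aut_invg aut_mul.
Proof. by move=> a; apply: graph_aut_ext => x; exact: aut_homK. Qed.

Lemma aut_mulrV : right_inverse aut_one aut_invg aut_mul.
Proof. by move=> a; apply: graph_aut_ext => x; exact: aut_invK. Qed.

HB.instance Definition _ := gen_eqMixin (graph_aut X).
HB.instance Definition _ := gen_choiceMixin (graph_aut X).
HB.instance Definition _ :=
  isGroup.Build (graph_aut X) aut_mulA aut_mul1 aut_mulr1 aut_mulV aut_mulrV.

End AutGroup.

Section ArrowAut.
Variables (X Y : graph) (phi : graph_hom X Y).

Definition arrow_aut_set : set (graph_aut X * graph_aut Y) :=
  [set ab : graph_aut X * graph_aut Y |
     forall x, ab.2 (phi x) = phi (ab.1 x)].

Lemma arrow_aut_closed : group_closed (mem arrow_aut_set).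
Proof.
split=> [|[a b] [c d]]; first exact/mem_set.
move=> /set_mem /= ab /set_mem /= cd; apply/mem_set => x /=.
have dc : aut_inv d (phi x) = phi (aut_inv c x).
  by rewrite -[in LHS](aut_invK c x) -(cd (aut_inv c x)) /= aut_homK.
by rewrite dc; exact: (ab (aut_inv c x)).
Qed.

Definition arrow_aut : groupType := subgroup arrow_aut_closed.

End ArrowAut.

(* Main.v *)
From Stdlib Require Relation_Operators.
From HB Require Import structures.
Require Import Defs.
From mathcomp Require Import all_boot all_classical.
From mathcomp Require Import wochoice.
Set Implicit Arguments. Unset Strict Implicit. Unset Printing Implicit Defensive.

Local Open Scope group_scope.

(** A group is the automorphism group of its coloured Cayley graph, so the
    classical realization of a group by a graph has two ingredients: a
    combinatorial structure whose colour-preserving automorphisms are the left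
    translations, and a way of fixing the colours inside a plain graph.

    The structure attached to a group [G] and an index type [I] consists of
    points.  The flag [(x, c)], for [x] and [c] in [G], is joined to the source
    point of [x] and to the target point of [x * c].  When flags keep their
    label, an automorphism moves the source points by some permutation [s],
    hence the flags [(x, c)] to [(s x, c)], hence the target point of [x * c] to
    that of [s x * c].  Taking [x = 1] and [c = 1] in turn identifies the two
    permutations and forces [s x = s 1 * x]
    ([move_autE]).  Further flags [(x, i)], for [i] in [I], carry a point for
    each subset [A] of [I * G], joined to its members; such a point must follow
    the translation, so it does not enlarge the automorphism group.  Unlike the
    other points it may have a nontrivial stabilizer in [G], which the image of
    a point under the morphism below must be able to have.

    Colours may be arbitrarily numerous, so they are fixed by a well-order: the
    half graph that joins the upper copy of [k] to the lower copies of the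
    elements up to [k] has no automorphism preserving both sides but the
    identity ([half_graph_rigid]).  A hub carrying the only vertex of degree one
    makes the upper side, then the lower side, recognizable in the plain graph
    ([frame_aut_labels]).

    For a subgroup [H] of [G1 * G2], the first graph is that of [G1] with no
    extra index, the second that of [G2] with index type [G1].  The morphism
    sends the source point of [x] to the subset
    [slice x = {(i, y) | (x * i, y) in H}] of [G1 * G2].  Left translation by [h]
    on the second coordinate turns [slice x] into [slice (g * x)] whenever
    [(g, h)] lies in [H]; conversely [(1, 1)] belongs to [slice 1], so if the
    translate of [slice 1] is [slice g] then [(1, h)] belongs to [slice g], that
    is, [(g, h)] is in [H] ([slice_aut]).  All other vertices are sent to
    fixed vertices of a triangle two of whose corners are adjacent to every
    subset point. *)

(** * Rigidity of half graphs *)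

Lemma well_order_refl (K : eqType) (R : rel K) : well_order R -> reflexive R.
Proof.
by move=> wo x; apply: (@wo_chain_reflexive _ R predT) => // A _; apply: wo.
Qed.

Lemma well_order_antisymmetric (K : eqType) (R : rel K) :
  well_order R -> antisymmetric R.
Proof.
by move=> wo x y; apply: (@wo_chain_antisymmetric _ R predT) => // A _; apply: wo.
Qed.

(** At the least element [c] moved by [s] or [t], both maps and their inverses
    send the final segment of [c] to itself, because everything below [c] is
    fixed.  Comparing the images of [c] and of its preimages with [c] then
    forces [s c = c] and [t c = c]. *)
Lemma half_graph_rigid (K : eqType) (R : rel K) (s t : K -> K) :
    well_order R -> bijective s -> bijective t ->
    (forall x y, R (s x) (t y) = R x y) ->
  forall k, s k = k /\ t k = k.
Proof.
move=> wo [s' sK s'K] [t' tK t'K] stR k; apply: contrapT => nk.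
have [| c [[]]] := wo [pred x | `[< ~ (s x = x /\ t x = x) >]].
  by exists k; apply/asboolP.
move=> /asboolP nc low _; apply: nc.
have fix_st x : ~~ R c x -> s x = x /\ t x = x.
  by move=> nR; apply: contrapT => nx; case/negP: nR; apply/low/asboolP.
have fix_s x : ~~ R c x -> s x = x by case/fix_st.
have fix_t x : ~~ R c x -> t x = x by case/fix_st.
have anti x : R c x -> R x c -> x = c.
  by move=> ? ?; apply: (well_order_antisymmetric wo); apply/andP.
have above f : injective f -> (forall x, ~~ R c x -> f x = x) ->
    forall x, R c x -> R c (f x).
  move=> f_inj fix_f x Rcx; apply: contrapT => /negP nR.
  by move: (fix_f _ nR) => /f_inj fx; rewrite fx Rcx in nR.
have above_inv f f' : cancel f' f -> (forall x, ~~ R c x -> f x = x) ->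
    forall x, R c x -> R c (f' x).
  move=> f'K fix_f x Rcx; apply: contrapT => /negP nR.
  by move: (fix_f _ nR); rewrite f'K => fx; rewrite -fx Rcx in nR.
have Rcc := well_order_refl wo c.
have sc : s c = c.
  have /anti s'c : R c (s' c) by exact: above_inv s'K fix_s _ _.
  rewrite -{1}s'c ?s'K // -stR s'K.
  exact: above (can_inj tK) fix_t _ _.
split=> //.
have Rt'c : R c (t' c) by exact: above_inv t'K fix_t _ _.
have t'c : t' c = c; last by rewrite -{1}t'c t'K.
apply: (can_inj sK); rewrite sc; apply: anti.
  exact: above (can_inj sK) fix_s _ _.
by rewrite -{2}(t'K c) stR; exact: well_order_refl.
Qed.

(** * Graph automorphisms *)

Lemma aut_adj (X : graph) (a : graph_aut X) x y : adj (a x) (a y) <-> adj x y.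
Proof.
split=> [axy|]; last exact: hom_adj.
by rewrite -(aut_homK a x) -(aut_homK a y); exact: hom_adj.
Qed.

Definition is_leaf (X : graph) (x : X) :=
  forall y z, adj x y -> adj x z -> y = z.

Lemma aut_leaf (X : graph) (a : graph_aut X) x : is_leaf x -> is_leaf (a x).
Proof.
move=> lx y z; rewrite -(aut_invK a y) -(aut_invK a z) => /aut_adj xy /aut_adj xz.
by rewrite (lx _ _ xy xz).
Qed.

(** * Encoding vertex colours in a plain graph *)

Section Frame.
Variables (K : eqType) (R : rel (option K)).
Variables (P : Type) (kind : P -> K) (edge : P -> P -> Prop) (anchor : K).
Hypothesis woR : well_order R.
Hypothesis edge_irr : forall p, ~ edge p p.
Hypothesis kind_surj : forall k, exists p, kind p = k.

(** [Up] and [Lab] are the two sides of the half graph of [R].  The label [None]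
    is an additional colour shared by all points. *)
Inductive frame_vertex :=
  Leaf | Hub | Up of option K | Lab of option K | Pt of P.

(** The edge between the labels [None] and [Some anchor] makes a triangle with
    each point of colour [anchor], so that every 3-colourable graph maps to
    the frame. *)
Definition frame_arc u v : Prop :=
  match u, v with
  | Leaf, Hub => True
  | Hub, Up _ => True
  | Up k, Lab l => R l k
  | Lab k, Lab l => k = None /\ l = Some anchor
  | Lab k, Pt p => k = None \/ k = Some (kind p)
  | Pt p, Pt q => edge p q
  | _, _ => False
  end.

Definition frame_adj u v := frame_arc u v \/ frame_arc v u.

Lemma frame_adj_sym u v : frame_adj u v -> frame_adj v u.
Proof. by case; [right | left]. Qed.

Lemma frame_adj_irr u : ~ frame_adj u u.
Proof. by case: u => [||k|k|p] [] //=; (try by case=> ->); exact: edge_irr. Qed.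

Lemma frame_connected u v :
  Relation_Operators.clos_refl_trans frame_vertex frame_adj u v.
Proof.
pose conn := Relation_Operators.clos_refl_trans frame_vertex frame_adj.
have conn1 x y : frame_adj x y -> conn x y by exact: Relation_Operators.rt_step.
have connT y x z : conn x y -> conn y z -> conn x z.
  exact: Relation_Operators.rt_trans.
have connC x y : conn x y -> conn y x.
  elim=> [a b ab|a|a b c _ ba _ cb]; last exact: connT cb ba.
    exact/conn1/frame_adj_sym.
  exact: Relation_Operators.rt_refl.
have up_hub k : conn (Up k) Hub by apply: conn1; right.
have lab_hub k : conn (Lab k) Hub.
  by apply: connT (up_hub k); apply: conn1; right; exact: well_order_refl.
have to_hub x : conn x Hub.
  case: x => [||k|k|p] //; first by apply: conn1; left.
    exact: Relation_Operators.rt_refl.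
  by apply: connT (lab_hub None); apply: conn1; right; left.
exact: connT (to_hub u) (connC _ _ (to_hub v)).
Qed.

Definition frame : graph :=
  Graph frame_adj_sym frame_adj_irr (inhabits Hub) frame_connected.

(** The greatest element of the well-order, if any, has its own copy as its only
    neighbour on the upper side.  Its label still has a second neighbour: a
    point of that colour, by surjectivity of [kind], or, for the label [None],
    the label [Some anchor]. *)
Lemma frame_leaf (u : frame) : is_leaf u <-> u = Leaf.
Proof.
split=> [lu|->]; last by case=> [||k|k|p] [||l|l|q] [] // _ [].
case: u lu => [||k|k|p] // lu.
- by suff: Leaf = Up None by []; apply: lu; [right | left].
- suff: Hub = Lab k by [].
  by apply: lu; [right | left; exact: well_order_refl].
- case: k lu => [k|] lu.
    have [p kp] := kind_surj k; suff: Up (Some k) = Pt p by [].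
    by apply: lu; [right; exact: well_order_refl | left; right; rewrite kp].
  suff: Up None = Lab (Some anchor) by [].
  by apply: lu; [right; exact: well_order_refl | left].
- suff: Lab None = Lab (Some (kind p)) by [].
  by apply: lu; right; [left | right].
Qed.

Lemma frame_aut_Leaf (a : graph_aut frame) : a Leaf = Leaf.
Proof. by apply/frame_leaf/aut_leaf/frame_leaf. Qed.

Lemma frame_aut_Hub (a : graph_aut frame) : a Hub = Hub.
Proof.
have : adj (a Leaf) (a Hub) by apply/aut_adj; left.
by rewrite frame_aut_Leaf; case: (a Hub) => [||k|k|p] [].
Qed.

(** The neighbours of [Hub] are [Leaf] and the upper side. *)
Lemma frame_aut_Up_ex (a : graph_aut frame) k : exists l, a (Up k) = Up l.
Proof.
have : adj (a Hub) (a (Up k)) by apply/aut_adj; left.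
rewrite frame_aut_Hub; case E: (a (Up k)) => [||l|l|p] [] // _; last by exists l.
by move: (frame_aut_Leaf a); rewrite -{2}E => /(can_inj (aut_homK a)).
Qed.

(** The neighbours of the upper side are [Hub] and the labels. *)
Lemma frame_aut_Lab_ex (a : graph_aut frame) k : exists l, a (Lab k) = Lab l.
Proof.
have : adj (a (Up k)) (a (Lab k)).
  by apply/aut_adj; left; exact: well_order_refl.
have [m ->] := frame_aut_Up_ex a k.
case E: (a (Lab k)) => [||l|l|p] [] // _; last by exists l.
by move: (frame_aut_Hub a); rewrite -{2}E => /(can_inj (aut_homK a)).
Qed.

Lemma frame_aut_labels (a : graph_aut frame) k :
  a (Lab k) = Lab k /\ a (Up k) = Up k.
Proof.
have lab b l := cid (frame_aut_Lab_ex b l).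
have up b l := cid (frame_aut_Up_ex b l).
pose a' := aut_invg a.
have inverse b b' (bK : cancel (aut_hom b) (aut_hom b')) :
  cancel (fun l => sval (lab b l)) (fun l => sval (lab b' l)) /\
  cancel (fun l => sval (up b l)) (fun l => sval (up b' l)).
  split=> l /=; case: (lab b l) (up b l) => m /= bm; case=> n /= bn.
    by case: (lab b' m) => q /= bq; move: (bK (Lab l)); rewrite bm bq => -[].
  by case: (up b' n) => q /= bq; move: (bK (Up l)); rewrite bn bq => -[].
have [labK upK] := inverse a a' (@aut_homK _ a).
have [labK' upK'] := inverse a' a (@aut_invK _ a).
have labupR x y : R (sval (lab a x)) (sval (up a y)) = R x y.
  have ladj l m : adj (Up m : frame) (Lab l) <-> R l m by split=> [[]|]; [| |left].
  apply/idP/idP => /ladj uv; apply/ladj.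
    by apply/(aut_adj a); move: uv; case: (lab a x) (up a y) => m /= -> [n /= ->].
  by move/(aut_adj a): uv; case: (lab a x) (up a y) => m /= -> [n /= ->].
have [] :=
  half_graph_rigid woR (Bijective labK labK') (Bijective upK upK') labupR k.
by case: (lab a k) (up a k) => m /= -> [n /= ->] -> ->.
Qed.

(** All vertices that are not points are fixed, so points are permuted; and the
    label of its colour is the one label other than [None] next to a point. *)
Lemma frame_aut_Pt (a : graph_aut frame) p :
  exists2 q, a (Pt p) = Pt q & kind q = kind p.
Proof.
have fixed_image (u : frame) : a u = u -> u = a (Pt p) -> u = Pt p.
  by move=> au uE; apply: (can_inj (aut_homK a)); rewrite au.
case E: (a (Pt p)) => [||k|k|q].
- by have := fixed_image _ (frame_aut_Leaf a) (esym E).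
- by have := fixed_image _ (frame_aut_Hub a) (esym E).
- by have := fixed_image _ (frame_aut_labels a k).2 (esym E).
- by have := fixed_image _ (frame_aut_labels a k).1 (esym E).
exists q => //.
have : adj (a (Lab (Some (kind p)))) (a (Pt p)).
  by apply/aut_adj; left; right.
by rewrite E (frame_aut_labels a _).1 => -[[|[]]|].
Qed.

End Frame.

Arguments Pt {K P} p.

(** * A graph with a prescribed automorphism group *)

Section Realization.
Variables (G : groupType) (I : Type).

Inductive point :=
  | Src of G
  | Tgt of G
  | Flag of G & G + I
  | Sub of set (I * G).

Inductive colour := CSrc | CTgt | CFlag of G + I | CSub.

HB.instance Definition _ := gen_eqMixin colour.

Definition point_colour p :=
  match p with
  | Src _ => CSrc
  | Tgt _ => CTgt
  | Flag _ j => CFlag j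
  | Sub _ => CSub
  end.

Definition incident p q : Prop :=
  match p, q with
  | Flag x j, Src y => x = y
  | Flag x j, Tgt y => if j is inl c then x * c = y else False
  | Flag x j, Sub A => if j is inr i then A (i, x) else False
  | _, _ => False
  end.

Lemma incident_irr p : ~ incident p p.
Proof. by case: p => [x|x|x j|A]. Qed.

Lemma point_colour_surj k : exists p, point_colour p = k.
Proof.
case: k => [||j|]; first by exists (Src 1).
- by exists (Tgt 1).
- by exists (Flag 1 j).
by exists (Sub set0).
Qed.

Definition colour_order : rel (option colour) :=
  sval (well_ordering_principle (option colour)).

Lemma colour_order_wo : well_order colour_order.
Proof. exact: svalP. Qed.

Definition group_graph : graph :=
  frame point_colour CSub colour_order_wo incident_irr.

Definition translate (g : G) (A : set (I * G)) : set (I * G) :=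
  [set iy | A (iy.1, g^-1 * iy.2)]%classic.

Definition move_point (g : G) (p : point) : point :=
  match p with
  | Src x => Src (g * x)
  | Tgt x => Tgt (g * x)
  | Flag x j => Flag (g * x) j
  | Sub A => Sub (translate g A)
  end.

Definition move (g : G) (u : group_graph) : group_graph :=
  match u with Pt p => Pt (move_point g p) | _ => u end.

Lemma translateK g : cancel (translate g) (translate g^-1).
Proof.
by move=> A; apply/funext => -[i y]; rewrite /translate /= invgK mulKg.
Qed.

Lemma moveK g : cancel (move g) (move g^-1).
Proof.
by case=> [||k|k|[x|x|x j|A]] //=; rewrite ?mulKg ?translateK.
Qed.

Lemma moveKV g : cancel (move g^-1) (move g).
Proof. by move=> u; rewrite -{1}(invgK g) moveK. Qed.

Lemma move_arc g u v :
  frame_arc colour_order point_colour incident CSub u v ->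
  frame_arc colour_order point_colour incident CSub (move g u) (move g v).
Proof.
case: u v => [||k|k|p] [||l|l|q] //=; first by case: q.
case: p q => [x|x|x [c|i]|A] [y|y|y j|B] //=; try by move=> <-.
- by move=> <-; rewrite mulgA.
by rewrite /translate /= mulKg.
Qed.

Lemma move_adj g (u v : group_graph) : adj u v -> adj (move g u) (move g v).
Proof. by case=> /(move_arc g); [left | right]. Qed.

Definition move_hom g : graph_hom group_graph group_graph :=
  GraphHom (@move_adj g).

Definition move_aut g : graph_aut group_graph :=
  @GraphAut group_graph (move_hom g) (move_hom g^-1) (moveK g) (moveKV g).

Definition src_val (u : group_graph) : G := if u is Pt (Src x) then x else 1.

Definition shift (a : graph_aut group_graph) : G := src_val (a (Pt (Src 1))).

(** Source points determine their flags, and flags determine the remaining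
    points: the flags [(x, c)] for all [c] make the permutation of the source
    points commute with right multiplication. *)
Lemma move_autE a : a = move_aut (shift a).
Proof.
have aP := frame_aut_Pt point_colour_surj a.
pose s x := src_val (a (Pt (Src x))).
have aSrc x : a (Pt (Src x)) = Pt (Src (s x)).
  by rewrite /s; case: (aP (Src x)) => -[y|y|y l|B] //= ->.
have aFlag x j : a (Pt (Flag x j)) = Pt (Flag (s x) j).
  case: (aP (Flag x j)) => -[y|y|y l|B] //= E [lj]; rewrite E lj.
  have : adj (a (Pt (Flag x j))) (a (Pt (Src x))) by apply/aut_adj; left.
  by rewrite E aSrc => -[|//] /= ->.
have aTgt x c : a (Pt (Tgt (x * c))) = Pt (Tgt (s x * c)).
  case: (aP (Tgt (x * c))) => -[y|y|y l|B] //= E _; rewrite E.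
  have : adj (a (Pt (Flag x (inl c)))) (a (Pt (Tgt (x * c)))).
    by apply/aut_adj; left.
  by rewrite aFlag E => -[|//] /= ->.
have sE x : s x = s 1 * x.
  (* Both flags (x, 1) and (1, x) point to the target x. *)
  by have := aTgt x 1; rewrite mulg1 -{1}(mul1g x) aTgt mulg1 => -[].
apply: graph_aut_ext => -[||k|k|[x|x|x j|A]] /=.
- exact: frame_aut_Leaf point_colour_surj a.
- exact: frame_aut_Hub point_colour_surj a.
- by case: (frame_aut_labels point_colour_surj a k).
- by case: (frame_aut_labels point_colour_surj a k).
- by rewrite aSrc sE.
- by rewrite -{1}(mul1g x) aTgt.
- by rewrite aFlag sE.
case: (aP (Sub A)) => -[y|y|y l|B] //= E _; rewrite E.
congr (Pt (Sub _)); apply/funext => -[i y]; apply/propext.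
have flag_sub (x : G) (D : set (I * G)) :
    adj (Pt (Flag x (inr i)) : group_graph) (Pt (Sub D)) <-> D (i, x).
  by split=> [[]|]; [| | left].
have sy : s ((shift a)^-1 * y) = y by rewrite sE mulVKg.
split=> [By|Ay].
  apply/(flag_sub _ A)/(aut_adj a); rewrite aFlag E sy; exact/flag_sub.
by apply/flag_sub; rewrite -E -sy -aFlag; apply/aut_adj/flag_sub.
Qed.

Lemma shift_mul a b : shift (a * b) = shift a * shift b.
Proof.
rewrite {1}(move_autE a) {1}(move_autE b) /shift /=; rewrite mulg1.
by rewrite -/(shift a) -/(shift b).
Qed.

HB.instance Definition _ :=
  isMultiplicative.Build (graph_aut group_graph) G shift shift_mul.

Lemma move_autK : cancel move_aut shift.
Proof. by move=> g; rewrite /shift /= mulg1. Qed.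

Lemma shiftK : cancel shift move_aut.
Proof. by move=> a; rewrite -move_autE. Qed.

Lemma aut_group_graph : group_iso (graph_aut group_graph) G.
Proof.
by exists shift; exists move_aut; [exact: shiftK | exact: move_autK].
Qed.

End Realization.

Arguments Src {G I} x.
Arguments move_aut {G I} g.

(** * Restricting an isomorphism to corresponding subgroups *)

Section Restrict.
Variables (A B : groupType) (f : {multiplicative A -> B}) (f' : B -> A).
Variables (S : set A) (T : set B).
Hypotheses (hS : group_closed (mem S)) (hT : group_closed (mem T)).
Hypotheses (fK : cancel f f') (f'K : cancel f' f).
Hypothesis fST : forall a, S a <-> T (f a).

Definition restrict (a : subgroup hS) : subgroup hT :=
  Subgroup hT (mem_set ((fST a).1 (set_mem (subgroup_valP a)))).

Lemma restrict_mul : {morph restrict : a b / a * b}.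
Proof. by move=> a b; apply: val_inj; rewrite /= gmulfM. Qed.

HB.instance Definition _ :=
  isMultiplicative.Build (subgroup hS) (subgroup hT) restrict restrict_mul.

Lemma restrict_iso : group_iso (subgroup hS) (subgroup hT).
Proof.
have back b : T b -> S (f' b) by move=> Tb; apply/fST; rewrite f'K.
exists restrict.
exists (fun b : subgroup hT =>
  Subgroup hS (mem_set (back b (set_mem (subgroup_valP b))))).
  by move=> a; apply: val_inj; rewrite /= fK.
by move=> b; apply: val_inj; rewrite /= f'K.
Qed.

End Restrict.

(** * The morphism attached to a subgroup of a product *)

Section Arrow.
Variables (G1 G2 : groupType) (H : set (G1 * G2)).
Hypothesis hH : group_closed (mem H).

Let X1 := group_graph G1 void.
Let X2 := group_graph G2 G1.

Definition slice (x : G1) : set (G1 * G2) :=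
  [set iy | H (x * iy.1, iy.2)]%classic.

(** Outside the source points this is a colouring by the three corners of the
    triangle [Lab None], [Lab (Some CSub)], [Pt (Sub set0)], which every
    automorphism of [X2] fixes.  Neighbours of source points only receive the
    first two colours, since these corners are adjacent to all subset points. *)
Definition slice_map (u : X1) : X2 :=
  match u with
  | Leaf => Lab _ (Some (CSub G2 G1))
  | Hub => Lab _ None
  | Up _ => Pt (Sub set0)
  | Lab (Some CSub) => Lab _ (Some (CSub G2 G1))
  | Lab _ => Lab _ None
  | Pt (Src x) => Pt (Sub (slice x))
  | Pt (Flag _ _) => Lab _ (Some (CSub G2 G1))
  | Pt _ => Pt (Sub set0)
  end.

Lemma slice_map_adj (u v : X1) : adj u v -> adj (slice_map u) (slice_map v).
Proof.
have root_anchor : @adj X2 (Lab _ None) (Lab _ (Some (CSub G2 G1))) by left.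
have root_sub B : @adj X2 (Lab _ None) (Pt (Sub B)) by left; left.
have anchor_sub B : @adj X2 (Lab _ (Some (CSub G2 G1))) (Pt (Sub B)).
  by left; right.
have symX2 (w z : X2) : adj w z -> adj z w := @adj_sym X2 w z.
have arc (w z : X1) : frame_arc (@colour_order G1 void) (@point_colour G1 void)
    (@incident G1 void) (CSub G1 void) w z -> adj (slice_map w) (slice_map z).
  case: w z => [||k|k|p] [||l|l|q] // arc_wz.
  - exact: symX2.
  - exact: root_sub.
  - case: l arc_wz => [[||?|]|] _; apply: symX2;
      by [apply: root_sub | apply: anchor_sub].
  - by case: arc_wz => -> ->.
  - case: q arc_wz => [y|y|y l|B] [] ->;
      by [apply: root_sub | apply: anchor_sub | apply: root_anchor].
  case: p q arc_wz => [x|x|x j|A] [y|y|y l|B] // _; exact: anchor_sub.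
by case=> [/arc|/arc /symX2].
Qed.

Definition slice_hom : graph_hom X1 X2 := GraphHom slice_map_adj.

Lemma slice_aut (a : graph_aut X1) (b : graph_aut X2) :
  arrow_aut_set slice_hom (a, b) <-> H (shift a, shift b).
Proof.
have H1 : H 1 := set_mem hH.1.
have HM : forall p q, H p -> H q -> H (p * q).
  by move=> p q /mem_set Hp /mem_set Hq; have /set_mem := group_closedM hH Hp Hq.
have HV p : H p -> H p^-1.
  by move=> /mem_set Hp; have /set_mem := group_closedV hH Hp.
rewrite {1}(move_autE a) {1}(move_autE b).
move: (shift a) (shift b) => g h; split=> [gh | Hgh].
  (* Evaluate the translate of slice 1, which is slice g, at (1, h). *)
  have [/(congr1 (fun A : set (G1 * G2) => A (1, h)))] := gh (Pt (Src 1)).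
  by rewrite /translate /slice /= !mulg1 mulVg => <-.
case=> [||k|[[]|]|[x|x|x j|A]] //=.
congr (Pt (Sub _)); apply/funext => -[i y]; rewrite /translate /slice /=.
apply/propext; split=> Hxi.
  by rewrite -[y in H (_, y)](mulVKg h) -mulgA; exact: (HM (_, _) (_, _) Hgh Hxi).
rewrite -[x * i](mulKg g) (mulgA g).
exact: (HM (_, _) (_, _) (HV _ Hgh) Hxi).
Qed.

Definition shift_pair (ab : graph_aut X1 * graph_aut X2) : G1 * G2 :=
  (shift ab.1, shift ab.2).

Lemma shift_pair_mul : {morph shift_pair : p q / p * q}.
Proof. by move=> p q; rewrite /shift_pair /= !shift_mul. Qed.

HB.instance Definition _ :=
  isMultiplicative.Build (graph_aut X1 * graph_aut X2)%type (G1 * G2)%type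
    shift_pair shift_pair_mul.

Lemma arrow_aut_slice : group_iso (arrow_aut slice_hom) (subgroup hH).
Proof.
apply: (@restrict_iso _ _ shift_pair (fun gh => (move_aut gh.1, move_aut gh.2))).
- by move=> [a b]; rewrite /shift_pair /= !shiftK.
- by move=> [g h]; congr pair; exact: move_autK.
by move=> [a b]; apply: slice_aut.
Qed.

End Arrow.

Theorem theorem1p2 (G1 G2 : groupType) (H : set (G1 * G2))
    (hH : group_closed (mem H)) :
  exists (X1 X2 : graph) (phi : graph_hom X1 X2),
    [/\ group_iso (arrow_aut phi) (subgroup hH),
        group_iso (graph_aut X1) G1
      & group_iso (graph_aut X2) G2].
Proof.
exists (group_graph G1 void), (group_graph G2 G1), (slice_hom H).
by split; [exact: arrow_aut_slice | exact: aut_group_graph..].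
Qed.
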